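(* Let $N_1,N_2,m,r$ be positive integers, let $\gamma\ge 1$, and let $$s = 100\gamma^4 r \qquad\text{and}\qquad t = 800\gamma^{12}s$$ be integers. Let $\mathcal{A}:\mathbb{R}^{N_1\times N_2}\to\mathbb{R}^m$ be a linear map satisfying the modified rank-restricted isometry property of order $t+s+r$ with ratio $\gamma_{t+s+r}\le\gamma$. Then there is a constant $d$ depending only on $\gamma$ and $\beta_{t+s+r}$ such that, for all $\mathbf{X}\in\mathbb{R}^{N_1\times N_2}$ and all $\mathbf{e}\in\mathbb{R}^m$, the sequence $(\mathbf{X}_n)_{n\ge 0}$ produced from $\mathbf{y}=\mathcal{A}\mathbf{X}+\mathbf{e}$ by $\mathbf{X}_0=\mathbf{0}$ and $$\mathbf{X}_{n+1} = H_s\big( \mathbf{X}_n + \mu_n H_t( \mathcal{A}^* \mathrm{sgn}(\mathbf{y}-\mathcal{A} \mathbf{X}_n) ) \big), \qquad n\ge 0,$$ with stepsize $$\mu_n = \frac{\|\mathbf{y}-\mathcal{A}\mathbf{X}_n\|_1}{\max\left\{ \|H_t(\mathcal{A}^*\mathrm{sgn}(\mathbf{y}-\mathcal{A}\mathbf{X}_n))\|_F^2,\ \dfrac{1}{4\gamma^2}\dfrac{\|\mathcal{A}(H_t(\mathcal{A}^*\mathrm{sgn}(\mathbf{y}-\mathcal{A}\mathbf{X}_n)))\|_1^2}{\|H_t(\mathcal{A}^*\mathrm{sgn}(\mathbf{y}-\mathcal{A}\mathbf{X}_n))\|_F^2}\right\}}$$ has the property that every cluster point $\mathbf{X}^\sharp$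 of $(\mathbf{X}_n)_{n\ge 0}$ satisfies $$\|H_r(\mathbf{X})-\mathbf{X}^\sharp\|_F \le d\,\|\mathcal{A}(\mathbf{X}-H_r(\mathbf{X}))+\mathbf{e}\|_1.$$
   Context: $\|\cdot\|_F$ is the Frobenius norm with inner product $\langle\cdot,\cdot\rangle_F$, and $\|\cdot\|_1$ is the $\ell_1$-norm on $\mathbb{R}^m$. $\mathcal{A}\mathbf{Z}$ means $\mathcal{A}(\mathbf{Z})$. The adjoint $\mathcal{A}^*:\mathbb{R}^m \to \mathbb{R}^{N_1\times N_2}$ is defined by $\langle \mathcal{A}^*(\mathbf{u}), \mathbf{Z}\rangle_F = \langle \mathbf{u}, \mathcal{A}(\mathbf{Z})\rangle$ for all $\mathbf{u}\in\mathbb{R}^m$, $\mathbf{Z}\in\mathbb{R}^{N_1\times N_2}$. The function $\mathrm{sgn}$ is applied entrywise, with $\mathrm{sgn}(0)=0$. Let $N=\min\{N_1,N_2\}$. For a matrix $\mathbf{Z}$ with singular value decomposition $\mathbf{Z}=\sum_{\ell=1}^N \sigma_\ell(\mathbf{Z})\mathbf{u}_\ell\mathbf{v}_\ell^*$, $\sigma_1(\mathbf{Z})\ge\cdots\ge\sigma_N(\mathbf{Z})\ge 0$, put $H_k(\mathbf{Z})=\sum_{\ell=1}^k \sigma_\ell(\mathbf{Z})\mathbf{u}_\ell\mathbf{v}_\ell^*$, a best approximation to $\mathbf{Z}$ by matrices of rank at most $k$ (if the singular value decomposition is not unique, one is chosen for each matrix); $H_k(\mathbf{Z})=\mathbf{Z}$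 if $k\ge N$. Modified rank-restricted isometry property: for a positive integer $k$, $\mathcal{A}$ satisfies it at order $k$ if there are $\alpha,\beta>0$ such that $\alpha\|\mathbf{Z}\|_F \le \|\mathcal{A}(\mathbf{Z})\|_1 \le \beta\|\mathbf{Z}\|_F$ for all $\mathbf{Z}\in\mathbb{R}^{N_1\times N_2}$ with $\mathrm{rank}(\mathbf{Z})\le k$. The optimal such constants (largest $\alpha$, smallest $\beta$) are denoted $\alpha_k,\beta_k$, and the ratio is $\gamma_k = \beta_k/\alpha_k\ge 1$. Convention: if $H_t(\mathcal{A}^* \mathrm{sgn}(\mathbf{y}-\mathcal{A} \mathbf{X}_n))=\mathbf{0}$, so that $\mu_n$ is not defined by its formula, the update term $\mu_n H_t(\cdots)$ is taken to be $\mathbf{0}$, so $\mathbf{X}_{n+1}=\mathbf{X}_n$. *)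

(* Defs.v *)
From HB Require Import structures.
From mathcomp Require Import all_boot all_order all_algebra.
From mathcomp Require Import all_classical all_reals all_analysis.

Set Implicit Arguments.
Unset Strict Implicit.
Unset Printing Implicit Defensive.

Import Order.TTheory GRing.Theory Num.Theory.
Import numFieldNormedType.Exports.

Local Open Scope classical_set_scope.
Local Open Scope ring_scope.

Section Norms.
Context {R : realType}.

(** On column vectors ([q = 1]) this is the standard inner product. *)
Definition frob_dot {p q : nat} (Z W : 'M[R]_(p, q)) : R :=
  \sum_(i < p) \sum_(j < q) Z i j * W i j.

(** The norm [`|Z|] provided by MathComp-Analysis on matrices is the maximum
    norm; both induce the same topology. *)
Definition frob_norm {p q : nat} (Z : 'M[R]_(p, q)) : R :=
  Num.sqrt (frob_dot Z Z).

Definition l1norm {m : nat} (u : 'cV[R]_m) : R := \sum_(i < m) `|u i ord0|.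

Definition sgn {m : nat} (u : 'cV[R]_m) : 'cV[R]_m := map_mx Num.sg u.

End Norms.

Section SVD.
Context {R : realType} {N1 N2 : nat}.

Record svd (Z : 'M[R]_(N1, N2)) : Type := Svd {
  svd_u : 'M[R]_(N1, minn N1 N2);
  svd_v : 'M[R]_(N2, minn N1 N2);
  svd_s : 'I_(minn N1 N2) -> R;
  svd_u_orthonormal : svd_u^T *m svd_u = 1%:M;
  svd_v_orthonormal : svd_v^T *m svd_v = 1%:M;
  svd_s_ge0 : forall l, 0 <= svd_s l;
  svd_s_noninc : forall k l : 'I_(minn N1 N2), (k <= l)%N -> svd_s l <= svd_s k;
  svd_decomposition :
    Z = \sum_(l < minn N1 N2) svd_s l *: (col l svd_u *m (col l svd_v)^T)
}.

(** [ch] fixes one singular value decomposition for each matrix; the truncation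
    is in general not determined by the matrix alone. Indices start at 0, and
    for [minn N1 N2 <= k] the sum is the whole decomposition, i.e. [Z]. *)
Definition H (ch : forall Z : 'M[R]_(N1, N2), svd Z) (k : nat)
    (Z : 'M[R]_(N1, N2)) : 'M[R]_(N1, N2) :=
  \sum_(l < minn N1 N2 | (l < k)%N)
     svd_s (ch Z) l *: (col l (svd_u (ch Z)) *m (col l (svd_v (ch Z)))^T).

Lemma H_ge ch k Z : (minn N1 N2 <= k)%N -> H ch k Z = Z.
Proof.
move=> kN; rewrite /H [RHS](svd_decomposition (ch Z)).
by apply: eq_bigl => l; rewrite (leq_trans (ltn_ord l)).
Qed.

End SVD.

Section RIP.
Context {R : realType} {N1 N2 m : nat}.
Implicit Types (A : 'M[R]_(N1, N2) -> 'cV[R]_m) (k : nat).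

Definition rip_lower A k (alpha : R) : Prop :=
  0 < alpha /\ forall Z : 'M[R]_(N1, N2), (\rank Z <= k)%N ->
    alpha * frob_norm Z <= l1norm (A Z).

Definition rip_upper A k (beta : R) : Prop :=
  0 < beta /\ forall Z : 'M[R]_(N1, N2), (\rank Z <= k)%N ->
    l1norm (A Z) <= beta * frob_norm Z.

Definition mrip A k : Prop :=
  exists alpha beta : R, rip_lower A k alpha /\ rip_upper A k beta.

(** Under [mrip A k], with [k], [N1] and [N2] positive, the supremum and the
    infimum are attained: they are the largest [alpha] and smallest [beta]. *)
Definition rip_alpha A k : R := sup [set alpha | rip_lower A k alpha].
Definition rip_beta A k : R := inf [set beta | rip_upper A k beta].
Definition rip_gamma A k : R := rip_beta A k / rip_alpha A k.

Definition is_adjoint A (Astar : 'cV[R]_m -> 'M[R]_(N1, N2)) : Prop :=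
  forall (u : 'cV[R]_m) (Z : 'M[R]_(N1, N2)),
    frob_dot (Astar u) Z = frob_dot u (A Z).

Lemma is_adjoint_exists (A : {linear 'M[R]_(N1, N2) -> 'cV[R]_m}) :
  exists Astar, is_adjoint A Astar.
Proof.
exists (fun u => \matrix_(i, j) frob_dot u (A (delta_mx i j))) => u Z.
have dotZ a V : frob_dot u (a *: V) = frob_dot u V * a.
  rewrite /frob_dot mulr_suml; apply: eq_bigr => i _; rewrite mulr_suml.
  by apply: eq_bigr => j _; rewrite !mxE mulrCA mulrC.
have dot_sum (I : finType) (F : I -> 'cV[R]_m) :
    frob_dot u (\sum_i F i) = \sum_i frob_dot u (F i).
  rewrite /frob_dot [RHS]exchange_big /=; apply: eq_bigr => i _.
  rewrite [RHS]exchange_big /=; apply: eq_bigr => j _.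
  by rewrite summxE mulr_sumr.
rewrite [in RHS](matrix_sum_delta Z) linear_sum dot_sum.
apply: eq_bigr => i _; rewrite linear_sum dot_sum; apply: eq_bigr => j _.
by rewrite linearZ dotZ mxE.
Qed.

End RIP.

Section Algorithm.
Context {R : realType} {N1 N2 m : nat}.
Context (ch : forall Z : 'M[R]_(N1, N2), svd Z)
  (A : 'M[R]_(N1, N2) -> 'cV[R]_m) (Astar : 'cV[R]_m -> 'M[R]_(N1, N2))
  (s t : nat) (gamma : R) (y : 'cV[R]_m).

Definition iht_dir (Xn : 'M[R]_(N1, N2)) : 'M[R]_(N1, N2) :=
  H ch t (Astar (sgn (y - A Xn))).

(** When [iht_dir Xn = 0] the denominator is [0] and, as [x / 0 = 0], so is the
    stepsize; the update term [iht_step Xn *: iht_dir Xn] is then [0]. *)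
Definition iht_step (Xn : 'M[R]_(N1, N2)) : R :=
  l1norm (y - A Xn) /
  Num.max (frob_norm (iht_dir Xn) ^+ 2)
          ((4 * gamma ^+ 2)^-1 *
           (l1norm (A (iht_dir Xn)) ^+ 2 / frob_norm (iht_dir Xn) ^+ 2)).

Fixpoint iht (n : nat) : 'M[R]_(N1, N2) :=
  if n is n'.+1
  then H ch s (iht n' + iht_step (iht n') *: iht_dir (iht n'))
  else 0.

End Algorithm.

(* Main.v *)
(** Write [x = H_r X], [e' = A (X - x) + e], [v = y - A X_n], [D = iht_dir X_n],
    [W = X_n - x] and [|.|] for the Frobenius norm; [x] has rank at most [r] and
    [A W = e' - v].

    Descent: [<Astar (sgn v), W> = <sgn v, e' - v> <= |e'|_1 - |v|_1], and
    truncating [Astar (sgn v)] to [D] perturbs this by at most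
    [sqrt ((s + r) / t) * beta * |W|], which the size of [t] makes a small
    fraction of [|A W|_1]. The stepsize satisfies [mu |D|^2 <= |v|_1], so
    [|W + mu D|^2 <= |W|^2 - c mu |v|_1] with [mu |v|_1 >= |v|_1^2 / beta^2]
    unless [|v|_1 <= 21 |e'|_1].

    Thresholding: [|x - H_s V|^2 <= (1 + 1 / (4 gamma^2)) |x - V|^2], because
    [s >= 100 gamma^4 r]; this loses less than the descent gains. Hence
    [|x - X_n|^2] either decreases by a fixed factor or is already at most a
    multiple of [|e'|_1^2 / beta^2], and the bound passes to cluster points. *)

Require Import Defs.
From HB Require Import structures.
From mathcomp Require Import all_boot all_order all_algebra.
From mathcomp Require Import all_classical all_reals all_analysis.
From mathcomp Require Import ring lra.

Set Implicit Arguments.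
Unset Strict Implicit.
Unset Printing Implicit Defensive.

Import Order.TTheory GRing.Theory Num.Theory.
Import numFieldNormedType.Exports.

Local Open Scope classical_set_scope.
Local Open Scope ring_scope.

(** * Frobenius inner product and orthogonal projections *)

Section FrobeniusTheory.
Context {R : realType}.

Lemma frob_dotE p q (Z W : 'M[R]_(p, q)) : frob_dot Z W = \tr (Z *m W^T).
Proof.
by apply: eq_bigr => i _; rewrite mxE; apply: eq_bigr => j _; rewrite mxE.
Qed.

Lemma frob_dotC p q (Z W : 'M[R]_(p, q)) : frob_dot Z W = frob_dot W Z.
Proof. by rewrite !frob_dotE -mxtrace_tr trmx_mul trmxK. Qed.

Lemma frob_dotDl p q (Z1 Z2 W : 'M[R]_(p, q)) :
  frob_dot (Z1 + Z2) W = frob_dot Z1 W + frob_dot Z2 W.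
Proof. by rewrite !frob_dotE mulmxDl linearD. Qed.

Lemma frob_dotDr p q (Z W1 W2 : 'M[R]_(p, q)) :
  frob_dot Z (W1 + W2) = frob_dot Z W1 + frob_dot Z W2.
Proof. by rewrite !(frob_dotC Z) frob_dotDl. Qed.

Lemma frob_dotZl p q a (Z W : 'M[R]_(p, q)) :
  frob_dot (a *: Z) W = a * frob_dot Z W.
Proof. by rewrite !frob_dotE -scalemxAl linearZ. Qed.

Lemma frob_dotZr p q a (Z W : 'M[R]_(p, q)) :
  frob_dot Z (a *: W) = a * frob_dot Z W.
Proof. by rewrite !(frob_dotC Z) frob_dotZl. Qed.

Lemma frob_dotNl p q (Z W : 'M[R]_(p, q)) :
  frob_dot (- Z) W = - frob_dot Z W.
Proof. by rewrite -scaleN1r frob_dotZl mulN1r. Qed.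

Lemma frob_dotNr p q (Z W : 'M[R]_(p, q)) :
  frob_dot Z (- W) = - frob_dot Z W.
Proof. by rewrite !(frob_dotC Z) frob_dotNl. Qed.

Lemma frob_sqrB p q (Z W : 'M[R]_(p, q)) :
  frob_dot (Z - W) (Z - W) =
  frob_dot Z Z - 2 * frob_dot Z W + frob_dot W W.
Proof.
rewrite frob_dotDl !frob_dotDr !frob_dotNl !frob_dotNr (frob_dotC W Z); ring.
Qed.

Lemma frob_dot_mulmxl p q n (P : 'M[R]_(n, p)) (Z : 'M[R]_(p, q)) W :
  frob_dot (P *m Z) W = frob_dot Z (P^T *m W).
Proof.
by rewrite !frob_dotE -mulmxA mxtrace_mulC trmx_mul trmxK mulmxA.
Qed.

Lemma frob_dot_mulmxr p q n (Z : 'M[R]_(p, q)) (Q : 'M[R]_(q, n)) W :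
  frob_dot (Z *m Q) W = frob_dot Z (W *m Q^T).
Proof. by rewrite !frob_dotE trmx_mul trmxK mulmxA. Qed.

Lemma frob_dot_ge0 p q (Z : 'M[R]_(p, q)) : 0 <= frob_dot Z Z.
Proof. by do 2!apply: sumr_ge0 => ? _; rewrite -expr2 sqr_ge0. Qed.

Lemma frob_dot_eq0 p q (Z : 'M[R]_(p, q)) : frob_dot Z Z = 0 -> Z = 0.
Proof.
have sq_ge0 i j : 0 <= Z i j * Z i j by rewrite -expr2 sqr_ge0.
move=> /psumr_eq0P Z0; apply/matrixP => i j; rewrite mxE.
have /psumr_eq0P Zi0 : \sum_(j < q) Z i j * Z i j = 0.
  by apply: Z0 => // k _; apply: sumr_ge0.
by have /eqP := Zi0 (fun j _ => sq_ge0 i j) j isT; rewrite mulf_eq0 orbb => /eqP.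
Qed.

Lemma frob_dot_CS p q (Z W : 'M[R]_(p, q)) :
  frob_dot Z W ^+ 2 <= frob_dot Z Z * frob_dot W W.
Proof.
have := frob_dot_ge0 W; rewrite le_eqVlt => /orP[/eqP/esym W0|W_gt0].
  by rewrite (frob_dot_eq0 W0) -(scale0r W) !frob_dotZr !mul0r mulr0 expr0n.
have := frob_dot_ge0 (frob_dot W W *: Z - frob_dot Z W *: W).
rewrite !(frob_dotDl, frob_dotDr, frob_dotNl, frob_dotNr, frob_dotZl, frob_dotZr).
rewrite (frob_dotC W Z); set a := frob_dot W W; set b := frob_dot Z W => h.
suff : 0 <= a * (frob_dot Z Z * a - b ^+ 2) by rewrite pmulr_rge0 // subr_ge0.
by apply: le_trans h _; rewrite le_eqVlt; apply/orP; left; apply/eqP; ring.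
Qed.

Lemma frob_norm_ge0 p q (Z : 'M[R]_(p, q)) : 0 <= frob_norm Z.
Proof. exact: sqrtr_ge0. Qed.

Lemma sqr_frob_norm p q (Z : 'M[R]_(p, q)) : frob_norm Z ^+ 2 = frob_dot Z Z.
Proof. by rewrite sqr_sqrtr ?frob_dot_ge0. Qed.

Lemma frob_norm_gt0 p q (Z : 'M[R]_(p, q)) : Z != 0 -> 0 < frob_norm Z.
Proof.
move=> Z0; rewrite sqrtr_gt0 lt_neqAle frob_dot_ge0 andbT eq_sym.
by apply: contra_neq Z0 => /frob_dot_eq0.
Qed.

Definition orthoproj p (Q : 'M[R]_p) := Q^T = Q /\ Q *m Q = Q.

Lemma orthoproj_compl p (Q : 'M[R]_p) : orthoproj Q -> orthoproj (1%:M - Q).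
Proof.
case=> QT QQ; split; first by rewrite linearB /= trmx1 QT.
by rewrite mulmxBl mul1mx mulmxBr mulmx1 QQ subrr subr0.
Qed.

(** Pythagoras: [|Z|^2 - |P Z|^2 = <Z, (1 - P) Z> = |(1 - P) Z|^2]. *)
Lemma frob_orthoproj_mulmxl p q (P : 'M[R]_p) (Z : 'M[R]_(p, q)) :
  orthoproj P -> frob_dot (P *m Z) (P *m Z) <= frob_dot Z Z.
Proof.
move=> PP; have PE (M : 'M[R]_p) :
    orthoproj M -> frob_dot (M *m Z) (M *m Z) = frob_dot Z (M *m Z).
  by case=> MT MM; rewrite frob_dot_mulmxl mulmxA MT MM.
have := frob_dot_ge0 ((1%:M - P) *m Z).
rewrite (PE _ PP) (PE _ (orthoproj_compl PP)) mulmxBl mul1mx.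
by rewrite frob_dotDr frob_dotNr subr_ge0.
Qed.

Lemma frob_dot_tr p q (Z W : 'M[R]_(p, q)) :
  frob_dot Z^T W^T = frob_dot Z W.
Proof. by rewrite !frob_dotE trmxK mxtrace_mulC -mxtrace_tr trmx_mul trmxK. Qed.

Lemma frob_orthoproj_mulmxr p q (Z : 'M[R]_(p, q)) (Q : 'M[R]_q) :
  orthoproj Q -> frob_dot (Z *m Q) (Z *m Q) <= frob_dot Z Z.
Proof.
move=> QQ; rewrite -frob_dot_tr -(frob_dot_tr Z) trmx_mul.
by case: (QQ) => -> _; apply: frob_orthoproj_mulmxl.
Qed.

Lemma orthoproj_frob p (Q : 'M[R]_p) : orthoproj Q -> frob_dot Q Q = \tr Q.
Proof. by case=> QT QQ; rewrite frob_dotE QT QQ. Qed.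

Lemma frob_isometry p q n (U : 'M[R]_(p, q)) (Y : 'M[R]_(q, n)) :
  U^T *m U = 1%:M -> frob_dot (U *m Y) (U *m Y) = frob_dot Y Y.
Proof. by move=> UU; rewrite frob_dot_mulmxl mulmxA UU mul1mx. Qed.

Lemma orthoproj_isometry p q (U : 'M[R]_(p, q)) (D : 'M[R]_q) :
  U^T *m U = 1%:M -> orthoproj D -> orthoproj (U *m D *m U^T).
Proof.
move=> UU [DT DD]; split; first by rewrite !trmx_mul trmxK DT mulmxA.
by rewrite -!mulmxA (mulmxA U^T) UU mul1mx (mulmxA D) DD.
Qed.

(** [U U^T] is an orthogonal projection, and [|U U^T Y| = |U^T Y|] since [U] is an isometry. *)
Lemma frob_coisometry p q n (U : 'M[R]_(p, q)) (Y : 'M[R]_(p, n)) :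
  U^T *m U = 1%:M -> frob_dot (U^T *m Y) (U^T *m Y) <= frob_dot Y Y.
Proof.
move=> UU; have id_proj : orthoproj (1%:M : 'M[R]_q).
  by split; rewrite ?trmx1 ?mulmx1.
have := frob_orthoproj_mulmxl Y (orthoproj_isometry UU id_proj).
by rewrite mulmx1 -mulmxA frob_isometry.
Qed.

(** If [u B B^T = 0], then [|u B|^2 = <u, u B B^T> = 0], so [u = 0] by freeness. *)
Lemma gram_unitmx p q (B : 'M[R]_(p, q)) : row_free B -> B *m B^T \in unitmx.
Proof.
move=> B_free; rewrite -row_free_unit -kermx_eq0; apply/eqP/matrixP => i j.
have /sub_kermxP rG : (row i (kermx (B *m B^T)) <= kermx (B *m B^T))%MS.
  exact: row_sub.
set u := row i _ in rG.
have uB0 : u *m B = 0.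
  apply: frob_dot_eq0; rewrite frob_dot_mulmxr -mulmxA rG.
  by rewrite -(scale0r u) frob_dotZr mul0r.
have u0 : u = 0 by apply: (row_free_inj B_free); rewrite mul0mx.
by move/matrixP/(_ ord0 j): u0; rewrite !mxE.
Qed.

(** For a basis [B] of the row space, take [Q = B^T (B B^T)^-1 B]. Its trace turns ranks into
    quantities that Frobenius estimates can see. *)
Lemma row_orthoproj p q (W : 'M[R]_(p, q)) :
  exists Q : 'M[R]_q, [/\ orthoproj Q, \tr Q = (\rank W)%:R & W *m Q = W].
Proof.
have : (W <= row_base W)%MS by rewrite eq_row_base.
have := row_base_free W; move: (row_base W) => B B_free /submxP[C WE].
have := gram_unitmx B_free; set G := B *m B^T => G_unit.
exists (B^T *m invmx G *m B); split.
- split; first by rewrite !trmx_mul trmx_inv trmx_mul !trmxK mulmxA.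
  by rewrite -!mulmxA (mulmxA B) (mulmxA G) mulmxV // mul1mx.
- by rewrite -mulmxA mxtrace_mulC -mulmxA mulVmx // mxtrace1.
- transitivity (C *m B); last by rewrite -WE.
  rewrite [X in X *m _ = _]WE.
  by rewrite -(mulmxA C) !(mulmxA B) mulmxV // mul1mx.
Qed.

End FrobeniusTheory.

(** * Singular value truncation *)

Section Truncation.
Context {R : realType}.

Definition dg {n} (f : 'I_n -> R) : 'M[R]_n := diag_mx (\row_l f l).

Lemma dg_tr n (f : 'I_n -> R) : (dg f)^T = dg f.
Proof. exact: tr_diag_mx. Qed.

Lemma dg_mul n (f g : 'I_n -> R) : dg f *m dg g = dg (fun l => f l * g l).
Proof.
by rewrite /dg mulmx_diag; congr diag_mx; apply/rowP => l; rewrite !mxE.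
Qed.

Lemma dg_sub n (f g : 'I_n -> R) : dg f - dg g = dg (fun l => f l - g l).
Proof.
by rewrite /dg -linearB; congr diag_mx; apply/rowP => l; rewrite !mxE.
Qed.

Lemma frob_dg_mul n p (f : 'I_n -> R) (Y : 'M[R]_(n, p)) :
  frob_dot (dg f *m Y) (dg f *m Y) = \sum_l f l ^+ 2 * (Y *m Y^T) l l.
Proof.
apply: eq_bigr => l _; rewrite mxE mulr_sumr; apply: eq_bigr => j _.
by rewrite mul_diag_mx !mxE; ring.
Qed.

Lemma gram_diag_ge0 n p (Y : 'M[R]_(n, p)) l : 0 <= (Y *m Y^T) l l.
Proof. by rewrite mxE sumr_ge0 // => j _; rewrite mxE -expr2 sqr_ge0. Qed.

Lemma orthoproj_dg n (P : pred 'I_n) : orthoproj (dg (fun l => (P l)%:R)).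
Proof.
split; first exact: dg_tr.
by rewrite dg_mul; congr dg; apply/funext => l; case: (P l); rewrite ?mulr1 ?mulr0.
Qed.

Lemma sum_col_dg p q n (U : 'M[R]_(p, n)) (V : 'M[R]_(q, n)) f :
  \sum_l f l *: (col l U *m (col l V)^T) = U *m dg f *m V^T.
Proof.
apply/matrixP => i j; rewrite summxE mxE; apply: eq_bigr => l _.
by rewrite mul_mx_diag !mxE big_ord1 !mxE; ring.
Qed.

Lemma sum_ord_lt_natr n k :
  (k <= n)%N -> \sum_(l < n) (l < k)%N%:R = k%:R :> R.
Proof.
move=> kn; rewrite -[in RHS](card_ord k) -sumr_const.
rewrite (big_ord_widen n (fun=> 1) kn) [RHS]big_mkcond.
by apply: eq_bigr => l _; case: (l < k)%N.
Qed.

Context {N1 N2 : nat} (ch : forall Z : 'M[R]_(N1, N2), svd Z).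
Implicit Types (Z W : 'M[R]_(N1, N2)) (k : nat).

Lemma svdE Z :
  Z = svd_u (ch Z) *m dg (svd_s (ch Z)) *m (svd_v (ch Z))^T.
Proof. by rewrite -sum_col_dg -svd_decomposition. Qed.

Lemma H_dg k Z :
  H ch k Z = svd_u (ch Z) *m dg (fun l => (l < k)%N%:R * svd_s (ch Z) l)
             *m (svd_v (ch Z))^T.
Proof.
rewrite -sum_col_dg /H big_mkcond; apply: eq_bigr => l _.
by case: (l < k)%N; rewrite ?mul1r // mul0r scale0r.
Qed.

Lemma sub_H_dg k Z :
  Z - H ch k Z = svd_u (ch Z) *m dg (fun l => (k <= l)%N%:R * svd_s (ch Z) l)
                 *m (svd_v (ch Z))^T.
Proof.
rewrite {1}[Z]svdE H_dg -mulmxBl -mulmxBr dg_sub; congr (_ *m dg _ *m _).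
by apply/funext => l; case: ltnP => _; rewrite !(mul1r, mul0r) ?subrr ?subr0.
Qed.

(** [P] projects onto the left singular vectors of index at least [k]. *)
Lemma sub_H_orthoproj k Z :
  exists2 P : 'M[R]_N1, orthoproj P & Z - H ch k Z = P *m Z.
Proof.
exists (svd_u (ch Z) *m dg (fun l => (k <= l)%N%:R) *m (svd_u (ch Z))^T).
  by apply: orthoproj_isometry (svd_u_orthonormal _) (orthoproj_dg _).
rewrite sub_H_dg [X in _ = _ *m X]svdE -!mulmxA (mulmxA _^T).
by rewrite svd_u_orthonormal mul1mx [in RHS](mulmxA (dg _)) dg_mul.
Qed.

Lemma mxrank_H k Z : (\rank (H ch k Z) <= k)%N.
Proof.
have [nk|/ltnW kn] := leqP (minn N1 N2) k.
  by apply: leq_trans nk; rewrite leq_min rank_leq_row rank_leq_col.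
rewrite /H (big_ord_narrow kn) -[leqRHS](card_ord k) -sum1_card.
elim/big_ind2: _ => [|Y1 a Y2 b Y1a Y2b|l _]; first by rewrite mxrank0.
  exact: leq_trans (mxrank_add _ _) (leq_add Y1a Y2b).
apply: leq_trans (mxrank_scale _ _) _.
exact: leq_trans (mxrankM_maxr _ _) (rank_leq_row _).
Qed.

(** [tau] is the first discarded singular value, or 0 when none is discarded. The last clause
    guarantees that there are [k] leading indices to count whenever [tau] is nonzero. *)
Lemma sub_H_threshold k Z : exists2 tau : R, 0 <= tau &
  [/\ forall l : 'I_(minn N1 N2), (k <= l)%N -> svd_s (ch Z) l <= tau,
      forall l : 'I_(minn N1 N2), (l < k)%N -> tau <= svd_s (ch Z) l &
      tau != 0 -> (k <= minn N1 N2)%N].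
Proof.
have [nk|kn] := leqP (minn N1 N2) k.
  exists 0 => //; split=> [l kl|l _|]; last by rewrite eqxx.
    by have := ltn_ord l; rewrite ltnNge (leq_trans nk kl).
  exact: svd_s_ge0.
exists (svd_s (ch Z) (Ordinal kn)); first exact: svd_s_ge0.
by split=> [l kl|l /ltnW lk|_]; rewrite ?svd_s_noninc //= ltnW.
Qed.

(* [tau] plays the role of the singular value of index [k] (counted from 0):
   it bounds the operator norm of the tail, and the part of the head that
   survives a projection killing only [\tr Q] dimensions. *)
Lemma sub_H_bound k Z : exists2 tau : R, 0 <= tau &
  (forall M : 'M[R]_N2,
     frob_dot ((Z - H ch k Z) *m M) ((Z - H ch k Z) *m M) <=
     tau ^+ 2 * frob_dot M M) /\
  (forall Q : 'M[R]_N2, orthoproj Q ->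
     tau ^+ 2 * (k%:R - \tr Q) <=
     frob_dot (H ch k Z *m (1%:M - Q)) (H ch k Z *m (1%:M - Q))).
Proof.
have [tau tau_ge0 [tail head tauN]] := sub_H_threshold k Z.
have UU := svd_u_orthonormal (ch Z); have VV := svd_v_orthonormal (ch Z).
exists tau => //; split=> [M|Q QP].
  rewrite sub_H_dg -!mulmxA frob_isometry // frob_dg_mul.
  apply: le_trans
    (_ : tau ^+ 2 * frob_dot ((svd_v (ch Z))^T *m M) ((svd_v (ch Z))^T *m M)
         <= _); last first.
    by rewrite ler_wpM2l ?sqr_ge0 // frob_coisometry.
  rewrite frob_dotE mulr_sumr; apply: ler_sum => l _.
  rewrite ler_wpM2r ?gram_diag_ge0 //; case: leqP => [kl|_].
    by rewrite mul1r ler_pXn2r ?nnegrE ?svd_s_ge0 // tail.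
  by rewrite mul0r expr0n sqr_ge0.
rewrite H_dg -!mulmxA frob_isometry // frob_dg_mul.
have [->|/tauN kn] := eqVneq tau 0.
  rewrite expr0n mul0r; apply: sumr_ge0 => l _.
  by rewrite mulr_ge0 ?sqr_ge0 ?gram_diag_ge0.
set V := svd_v (ch Z) in VV *.
(* Pythagoras for the right singular vector [v_l]: [|(1 - Q) v_l|^2 = 1 - |Q v_l|^2]. *)
have gramE l : (V^T *m (1%:M - Q) *m (V^T *m (1%:M - Q))^T) l l =
    1 - (V^T *m Q *m (V^T *m Q)^T) l l.
  have [QT QQ] := QP; have [CT CC] := orthoproj_compl QP.
  rewrite !trmx_mul trmxK CT QT -!mulmxA (mulmxA Q) QQ (mulmxA (1%:M - Q)) CC.
  by rewrite mulmxBl mul1mx mulmxBr VV !mxE eqxx.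
(* Indices at least [k] contribute nonpositive terms to this lower bound, so the full sum of
   [|Q v_l|^2] can be subtracted; it is at most [|Q|^2 = \tr Q]. *)
apply: le_trans (_ : \sum_(l < minn N1 N2)
    (tau ^+ 2 * ((l < k)%N%:R - (V^T *m Q *m (V^T *m Q)^T) l l)) <= _).
  rewrite -mulr_sumr sumrB sum_ord_lt_natr // ler_wpM2l ?sqr_ge0 //.
  by rewrite lerB // -[leLHS]/(\tr _) -frob_dotE -(orthoproj_frob QP) frob_coisometry.
apply: ler_sum => l _; have := gram_diag_ge0 (V^T *m (1%:M - Q)) l.
rewrite gramE; have := gram_diag_ge0 (V^T *m Q) l.
case: ltnP => [lk|_] q0 q1.
  rewrite mul1r ler_wpM2r // ler_pXn2r ?nnegrE ?svd_s_ge0 //; exact: head.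
by rewrite mul0r expr0n mul0r sub0r mulrN oppr_le0 mulr_ge0 ?sqr_ge0.
Qed.

(** Let [T] be the tail and [Q] the projection onto the row space of [W]. Then [<T, W> = <T Q, W>]
    and [|T Q|^2 <= tau^2 |Q|^2 = tau^2 \rank W]; conclude by Cauchy-Schwarz. *)
Lemma frob_dot_sub_H_bound k Z tau W :
  (forall M : 'M[R]_N2,
     frob_dot ((Z - H ch k Z) *m M) ((Z - H ch k Z) *m M) <=
     tau ^+ 2 * frob_dot M M) ->
  frob_dot (Z - H ch k Z) W ^+ 2 <= (\rank W)%:R * tau ^+ 2 * frob_dot W W.
Proof.
move=> tail; have [Q [QP <- WQ]] := row_orthoproj W.
rewrite -{1}WQ; have [QT _] := QP; rewrite -{1}QT -frob_dot_mulmxr.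
apply: le_trans (frob_dot_CS _ _) _; rewrite ler_wpM2r ?frob_dot_ge0 //.
by apply: le_trans (tail _) _; rewrite orthoproj_frob // mulrC.
Qed.

Lemma frob_H_orthogonal k Z : frob_dot (H ch k Z) (Z - H ch k Z) = 0.
Proof.
have [P [PT PP] TE] := sub_H_orthoproj k Z.
have HE : H ch k Z = Z - P *m Z by rewrite -TE opprB addrC subrK.
rewrite TE HE -{2}PT -frob_dot_mulmxl mulmxBr mulmxA PP subrr.
by rewrite -(scale0r (0 : 'M[R]_(N1, N2))) frob_dotZl mul0r.
Qed.

(* The tail [T = V - H_s V] is only seen by [x] through [P *m x], which is
   [P *m (x - H_s V)], [P] projecting onto the column space of [T]; as [P *m x]
   has rank at most [r], this beats Cauchy-Schwarz for [x - H_s V] by a factor [sqrt (r / s)]. *)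
Lemma H_cross_term s (x V : 'M[R]_(N1, N2)) :
  (s%:R - (\rank x)%:R) * frob_dot x (V - H ch s V) ^+ 2 <=
  (\rank x)%:R * frob_dot (x - V) (x - V)
    * frob_dot (x - H ch s V) (x - H ch s V).
Proof.
have [tau tau_ge0 [tail head]] := sub_H_bound s V.
have [P PP TE] := sub_H_orthoproj s V; have [PT PPE] := PP.
have [Q [QP trQ xQ]] := row_orthoproj x.
have HE : H ch s V = (1%:M - P) *m V.
  by rewrite mulmxBl mul1mx -TE opprB addrC subrK.
have cross : frob_dot x (V - H ch s V) ^+ 2 <=
    (\rank x)%:R * tau ^+ 2 * frob_dot (x - H ch s V) (x - H ch s V).
  have -> : frob_dot x (V - H ch s V) = frob_dot (V - H ch s V) (P *m x).
    by rewrite frob_dotC -{1}PT -frob_dot_mulmxl TE mulmxA PPE.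
  apply: le_trans (frob_dot_sub_H_bound (P *m x) tail) _.
  apply: ler_pM; rewrite ?mulr_ge0 ?sqr_ge0 ?frob_dot_ge0 //.
    by rewrite ler_wpM2r ?sqr_ge0 // ler_nat mxrankM_maxr.
  suff -> : P *m x = P *m (x - H ch s V) by apply: frob_orthoproj_mulmxl.
  by rewrite HE mulmxBr mulmxA mulmxBr mulmx1 PPE subrr mul0mx subr0.
(* Right multiplication by [1 - Q] kills [x] but at most [\rank x] of the [s] leading directions of
   [V], so what survives of [H_s V] is bounded by [|x - V|]. *)
have gap : tau ^+ 2 * (s%:R - (\rank x)%:R) <= frob_dot (x - V) (x - V).
  rewrite -trQ; apply: le_trans (head _ QP) _.
  rewrite HE -mulmxA.
  apply: le_trans (frob_orthoproj_mulmxl _ (orthoproj_compl PP)) _.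
  have -> : V *m (1%:M - Q) = (V - x) *m (1%:M - Q).
    by rewrite mulmxBl (mulmxBr x) xQ mulmx1 subrr subr0.
  apply: le_trans (frob_orthoproj_mulmxr _ (orthoproj_compl QP)) _.
  by rewrite -opprB frob_dotNl frob_dotNr opprK.
have [sr|rs] := lerP (s%:R : R) (\rank x)%:R.
  apply: le_trans (_ : 0 <= _); first by rewrite mulr_le0_ge0 ?sqr_ge0 ?subr_le0.
  by rewrite !mulr_ge0 ?frob_dot_ge0.
have sr_ge0 : 0 <= s%:R - (\rank x)%:R :> R by rewrite subr_ge0 ltW.
apply: le_trans (ler_wpM2l sr_ge0 cross) _; rewrite !mulrA ler_wpM2r ?frob_dot_ge0 //.
apply: le_trans (ler_wpM2l (ler0n R (\rank x)) gap).
rewrite [leLHS](_ : _ =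
  (\rank x)%:R * (tau ^+ 2 * (s%:R - (\rank x)%:R))) //; ring.
Qed.

(** The tail [T] is orthogonal to [H_s V], so expanding [|(x - H_s V) - T|^2] leaves [<x, T>] as
    cross term; [-|T|^2] is dropped. *)
Lemma frob_H_expand s (x V : 'M[R]_(N1, N2)) :
  frob_dot (x - H ch s V) (x - H ch s V) <=
  frob_dot (x - V) (x - V) + 2 * frob_dot x (V - H ch s V).
Proof.
have hT := frob_H_orthogonal s V; have T0 := frob_dot_ge0 (V - H ch s V).
have -> : x - V = (x - H ch s V) - (V - H ch s V) by rewrite opprB addrA subrK.
have xT : frob_dot (x - H ch s V) (V - H ch s V) = frob_dot x (V - H ch s V).
  by rewrite frob_dotDl frob_dotNl hT subr0.
by rewrite (frob_sqrB (x - H ch s V)) xT; lra.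
Qed.

(** Applied with [g = gamma^2]. The rank condition turns the cross term bound into [9 g c <= a b],
    and [2 a b <= a^2 + b^2] then yields [(9 g - 1) a^2 <= (9 g + 1) b^2]. *)
Lemma H_contraction s (g : R) (x V : 'M[R]_(N1, N2)) :
  1 <= g -> 100 * g ^+ 2 * (\rank x)%:R <= s%:R ->
  4 * g * frob_dot (x - H ch s V) (x - H ch s V) <=
  (4 * g + 1) * frob_dot (x - V) (x - V).
Proof.
move=> g1 rs; have := H_cross_term s x V; have := frob_H_expand s x V.
set c := frob_dot x _; rewrite -!sqr_frob_norm.
have a0 := frob_norm_ge0 (x - H ch s V); have b0 := frob_norm_ge0 (x - V).
set a := frob_norm _ in a0 *; set b := frob_norm _ in b0 * => expand cross.
have cE : \rank x = 0%N -> c = 0.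
  move/eqP; rewrite mxrank_eq0 => /eqP x0.
  by rewrite /c x0 -(scale0r 0) frob_dotZl mul0r.
have gc : (9 * g * c) ^+ 2 <= (a * b) ^+ 2.
  have [/cE -> |r_gt0] := posnP (\rank x).
    by rewrite mulr0 expr0n sqr_ge0.
  have {}r_gt0 : 0 < (\rank x)%:R :> R by rewrite ltr0n.
  rewrite -(ler_pM2l r_gt0); set r := _%:R in r_gt0 rs cross *.
  have rg : r <= g ^+ 2 * r by rewrite ler_peMl ?exprn_ege1 // ltW.
  have gap : 81 * (g ^+ 2 * r) <= s%:R - r by lra.
  have := ler_wpM2r (sqr_ge0 c) gap; nra.
have {}gc : 9 * g * c <= a * b.
  have [c0|/ltW c0] := lerP c 0.
    by apply: le_trans (_ : 0 <= _); rewrite ?mulr_ge0 //; nra.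
  by rewrite -(@ler_pXn2r _ 2) // nnegrE ?mulr_ge0 //; lra.
have ab : 2 * (a * b) <= a ^+ 2 + b ^+ 2 by have := sqr_ge0 (a - b); lra.
have key : (9 * g - 1) * a ^+ 2 <= (9 * g + 1) * b ^+ 2 by nra.
have b2 := sqr_ge0 b; have a2 := sqr_ge0 a.
have g9 : 0 < 9 * g - 1 by lra.
(* [(9 g + 1) / (9 g - 1) <= 1 + 1 / (4 g)] amounts to [1 <= g]. *)
rewrite -(ler_pM2l g9).
have -> : (9 * g - 1) * (4 * g * a ^+ 2) = 4 * g * ((9 * g - 1) * a ^+ 2) by ring.
apply: le_trans (ler_wpM2l _ key) _; first lra.
nra.
Qed.

End Truncation.

(** * The l1 norm and its sign functional *)

Section L1Norm.
Context {R : realType} {m : nat}.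
Implicit Types u v : 'cV[R]_m.

Lemma l1norm_ge0 u : 0 <= l1norm u.
Proof. exact: sumr_ge0. Qed.

Lemma l1normN u : l1norm (- u) = l1norm u.
Proof. by apply: eq_bigr => i _; rewrite mxE normrN. Qed.

Lemma ler_l1normD u v : l1norm (u + v) <= l1norm u + l1norm v.
Proof.
by rewrite -big_split; apply: ler_sum => i _; rewrite mxE ler_normD.
Qed.

Lemma frob_dot_sgn u : frob_dot (sgn u) u = l1norm u.
Proof. by apply: eq_bigr => i _; rewrite big_ord1 mxE normrEsg. Qed.

Lemma frob_dot_sgn_le u v : frob_dot (sgn u) v <= l1norm v.
Proof.
apply: ler_sum => i _; rewrite big_ord1 mxE.
apply: le_trans (ler_norm _) _; rewrite normrM ler_piMl ?normr_ge0 // normr_sg.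
by case: (_ != 0).
Qed.

End L1Norm.

(** * Attainment of the optimal isometry constants *)

Section RipConstants.
Context {R : realType} {N1 N2 m : nat}.
Implicit Types (A : 'M[R]_(N1, N2) -> 'cV[R]_m) (k : nat).

Lemma exists_mxrank1 : (0 < N1)%N -> (0 < N2)%N ->
  exists2 Z : 'M[R]_(N1, N2), Z != 0 & \rank Z = 1%N.
Proof.
move=> N1_gt0 N2_gt0.
exists (delta_mx (Ordinal N1_gt0) (Ordinal N2_gt0)); last exact: mxrank_delta.
by rewrite -mxrank_eq0 mxrank_delta.
Qed.

(** Each ratio [|A W|_1 / |W|] is an upper bound of the admissible [alpha], hence of their supremum;
    a rank-one matrix supplies one such bound, so the supremum is genuine. *)
Lemma rip_alphaP A k : (0 < N1)%N -> (0 < N2)%N -> (0 < k)%N ->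
  mrip A k -> rip_lower A k (rip_alpha A k).
Proof.
move=> N1_gt0 N2_gt0 k_gt0 [alpha [_ [Aalpha _]]].
have [Z Z0 rZ] := exists_mxrank1 N1_gt0 N2_gt0.
have ubd W : W != 0 -> (\rank W <= k)%N ->
    ubound [set a | rip_lower A k a] (l1norm (A W) / frob_norm W).
  by move=> W0 rW a [_ Aa]; rewrite ler_pdivlMr ?frob_norm_gt0 // Aa.
split.
  have [alpha_gt0 _] := Aalpha; apply: lt_le_trans alpha_gt0 _.
  apply: ub_le_sup => //; exists (l1norm (A Z) / frob_norm Z).
  by apply: ubd; rewrite ?rZ.
move=> W rW; have [->|W0] := eqVneq W 0.
  by rewrite /frob_norm -(scale0r 0) frob_dotZl mul0r sqrtr0 mulr0 l1norm_ge0.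
rewrite -ler_pdivlMr ?frob_norm_gt0 //; apply: ge_sup; first by exists alpha.
exact: ubd.
Qed.

(** Dual to the lower constant, except that positivity of the infimum comes from [alpha], tested on
    a rank-one matrix. *)
Lemma rip_betaP A k : (0 < N1)%N -> (0 < N2)%N -> (0 < k)%N ->
  mrip A k -> rip_upper A k (rip_beta A k).
Proof.
move=> N1_gt0 N2_gt0 k_gt0 [alpha [beta [[alpha_gt0 Aalpha] Abeta]]].
have [Z Z0 rZ] := exists_mxrank1 N1_gt0 N2_gt0.
have lbd W : W != 0 -> (\rank W <= k)%N ->
    lbound [set b | rip_upper A k b] (l1norm (A W) / frob_norm W).
  by move=> W0 rW b [_ Ab]; rewrite ler_pdivrMr ?frob_norm_gt0 // Ab.
have inf_ge W : W != 0 -> (\rank W <= k)%N ->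
    l1norm (A W) / frob_norm W <= rip_beta A k.
  by move=> W0 rW; apply: lb_le_inf; [exists beta|apply: lbd].
split.
  apply: lt_le_trans alpha_gt0 _; apply: le_trans (inf_ge Z Z0 _); rewrite ?rZ //.
  by rewrite ler_pdivlMr ?frob_norm_gt0 // Aalpha ?rZ.
move=> W rW; have [W0|W0] := eqVneq W 0; last first.
  by rewrite -ler_pdivrMr ?frob_norm_gt0 // inf_ge.
(* [A] is an arbitrary function here, so its value at 0 is controlled by the given upper bound, not
   by linearity. *)
have [_ /(_ W rW)] := Abeta.
by rewrite W0 /frob_norm -(scale0r 0) frob_dotZl mul0r sqrtr0 !mulr0.
Qed.

Lemma rip_gamma_le A k alpha beta gamma :
  rip_lower A k alpha -> rip_upper A k beta -> beta / alpha <= gamma ->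
  beta <= gamma * alpha.
Proof. by case=> alpha_gt0 _ _; rewrite ler_pdivrMr. Qed.

End RipConstants.

(** * One descent step before thresholding *)

Section Step.
Context {R : realType} {N1 N2 m : nat} (ch : forall Z : 'M[R]_(N1, N2), svd Z).
Context (A : {linear 'M[R]_(N1, N2) -> 'cV[R]_m})
  (Astar : 'cV[R]_m -> 'M[R]_(N1, N2)).
Context (adjA : is_adjoint A Astar).
Context (t k : nat) (alpha beta gamma : R).
Context (Alo : rip_lower A k alpha) (Aup : rip_upper A k beta).

(** With [D = H_t G] orthogonal to [G - D], [|D|^2 = <G, D> = <sgn v, A D>]. Together with the upper
    isometry bound this gives [|D| <= beta]. *)
Lemma frob_H_dir (v : 'cV[R]_m) : (t <= k)%N ->
  frob_dot (H ch t (Astar (sgn v))) (H ch t (Astar (sgn v))) <=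
  l1norm (A (H ch t (Astar (sgn v)))).
Proof.
move=> tk; set G := Astar _; have := frob_H_orthogonal ch t G.
rewrite frob_dotDr frob_dotNr => /eqP; rewrite subr_eq0 => /eqP <-.
by rewrite frob_dotC adjA frob_dot_sgn_le.
Qed.

(* The largest discarded singular value of [Astar (sgn v)] is at most
   [|H_t (Astar (sgn v))| / sqrt t <= beta / sqrt t]. *)
Lemma frob_dot_dir (v e : 'cV[R]_m) (W : 'M[R]_(N1, N2)) :
  (t <= k)%N -> (\rank W <= k)%N -> 1 <= gamma -> beta <= gamma * alpha ->
  400 * gamma ^+ 2 * (\rank W)%:R <= t%:R ->
  A W = e - v ->
  20 * frob_dot (H ch t (Astar (sgn v))) W <=
  21 * l1norm e - 19 * l1norm v.
Proof.
move=> tk rW g1 bga rt AW; have [alpha_gt0 AWlo] := Alo; have [beta_gt0 AWup] := Aup.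
set G := Astar _; have [tau tau_ge0 [tail head]] := sub_H_bound ch t G.
have cross := frob_dot_sub_H_bound W tail.
set D := H ch t G in tail head cross *.
have D_le : frob_dot D D <= beta ^+ 2.
  have DD := le_trans (frob_H_dir v tk) (AWup D (leq_trans (mxrank_H _ _ _) tk)).
  rewrite -/G -/D -sqr_frob_norm in DD *.
  have := frob_norm_ge0 D; rewrite le_eqVlt => /orP[/eqP <-|D0].
    by rewrite expr0n sqr_ge0.
  rewrite ler_pXn2r ?nnegrE ?frob_norm_ge0 ?(ltW beta_gt0) //.
  by rewrite -(ler_pM2r D0) -expr2.
have tau_le : tau ^+ 2 * t%:R <= beta ^+ 2.
  (* Take [Q = 0] in [head]. *)
  apply: le_trans D_le; have := head 0; rewrite mxtrace0 !subr0 mulmx1; apply.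
  by split; rewrite ?trmx0 ?mulmx0.
(* As [400 = 20^2], truncation will cost at most a twentieth of [|A W|_1]. *)
have rtau : 400 * ((\rank W)%:R * tau ^+ 2) <= alpha ^+ 2.
  have g_gt0 : 0 < gamma ^+ 2 by rewrite exprn_gt0 // (lt_le_trans ltr01).
  rewrite -(ler_pM2l g_gt0).
  have : beta ^+ 2 <= gamma ^+ 2 * alpha ^+ 2.
    rewrite -exprMn ler_pXn2r // nnegrE ?mulr_ge0 //; lra.
  have := ler_wpM2l (sqr_ge0 tau) rt; lra.
have cross20 : 20 * `|frob_dot (G - D) W| <= l1norm (A W).
  apply: le_trans (AWlo _ rW).
  rewrite -(@ler_pXn2r _ 2) ?nnegrE ?mulr_ge0 ?frob_norm_ge0 ?(ltW alpha_gt0) //.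
  rewrite !exprMn real_normK ?num_real // sqr_frob_norm.
  have := ler_wpM2r (frob_dot_ge0 W) rtau; lra.
have GW : frob_dot G W <= l1norm e - l1norm v.
  by rewrite adjA AW frob_dotDr frob_dotNr frob_dot_sgn lerD2r frob_dot_sgn_le.
(* The sum is [20 (|e|_1 - |v|_1) + (|e|_1 + |v|_1)]. *)
have := ler_norm (- frob_dot (G - D) W); rewrite normrN.
have := ler_l1normD e (- v); rewrite l1normN -AW.
rewrite frob_dotDl frob_dotNl in cross20 *; lra.
Qed.

End Step.

(** Here [w = |X_n - x|], [u = |v|_1], [eta = |e|_1], [c = <D, X_n - x>], [d = |D|^2],
    [b = |x - V|^2] for the unthresholded update [V], and [M] is the stepsize denominator;
    [c = d = 0] covers [D = 0]. If [u >= 21 eta] the residual forces descent; otherwise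
    [alpha w <= 22 eta] and the step is short. *)
Lemma step_arith (R : realType) (alpha beta gamma M mu d c w u eta b : R) :
  0 < alpha -> beta <= gamma * alpha -> 1 <= gamma ->
  0 <= w -> 0 <= u -> 0 <= eta -> 0 <= d -> 0 <= beta ->
  alpha * w <= u + eta -> 20 * c <= 21 * eta - 19 * u ->
  b = w ^+ 2 + 2 * mu * c + mu ^+ 2 * d ->
  (c = 0 /\ d = 0) \/
  [/\ mu = u / M, d <= M, alpha ^+ 2 <= 4 * gamma ^+ 2 * M & M <= beta ^+ 2] ->
  100 * (gamma ^+ 2 * b) <= (100 * gamma ^+ 2 - 72) * w ^+ 2 \/
  alpha ^+ 2 * b <= 1000 * gamma ^+ 2 * eta ^+ 2.
Proof.
move=> a0 bga g1 w0 u0 e0 d0 be0 aw cle bE cases.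
have g2 : 1 <= gamma ^+ 2 by rewrite exprn_ege1.
have small : u <= 21 * eta -> alpha ^+ 2 * w ^+ 2 <= 484 * eta ^+ 2.
  move=> ue; rewrite -exprMn [leRHS](_ : _ = (22 * eta) ^+ 2); last by ring.
  by rewrite ler_pXn2r ?nnegrE ?mulr_ge0 ?(ltW a0) //; lra.
have ee := sqr_ge0 eta.
have ge : eta ^+ 2 <= gamma ^+ 2 * eta ^+ 2 by rewrite ler_peMl.
case: cases => [[c0 dz]|[muE dM aM Mb]].
  right; have := small; rewrite bE c0 dz; lra.
have M0 : 0 < M.
  rewrite -(pmulr_rgt0 _ (_ : 0 < 4 * gamma ^+ 2)); last lra.
  by rewrite (lt_le_trans _ aM) ?exprn_gt0.
have mu0 : 0 <= mu by rewrite muE divr_ge0 // ltW.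
have muM : mu * M = u by rewrite muE divfK // gt_eqF.
have mud : mu ^+ 2 * d <= mu * u.
  by rewrite expr2 -mulrA ler_wpM2l // -muM ler_wpM2l.
have muc : mu * (20 * c) <= mu * (21 * eta - 19 * u) by rewrite ler_wpM2l.
have b_le : 10 * b <= 10 * w ^+ 2 + mu * (21 * eta - 9 * u) by lra.
have [ue|/ltW ue] := lerP (21 * eta) u.
  left; have mue : mu * (21 * eta) <= mu * u by rewrite ler_wpM2l.
  have {}b_le : 10 * b <= 10 * w ^+ 2 - 8 * (mu * u) by lra.
  have u2 : u ^+ 2 <= mu * u * beta ^+ 2.
    by rewrite mulrAC expr2 ler_wpM2r // -{1}muM ler_wpM2l.
  have b2 : beta ^+ 2 <= gamma ^+ 2 * alpha ^+ 2.
    by rewrite -exprMn ler_pXn2r ?nnegrE //; nra.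
  have aw2 : (21 * (alpha * w)) ^+ 2 <= (22 * u) ^+ 2.
    by rewrite ler_pXn2r ?nnegrE ?mulr_ge0 ?(ltW a0) //; lra.
  have mub := ler_wpM2l (mulr_ge0 mu0 u0) b2.
  (* [(21 / 22)^2 >= 9 / 10] explains 90; the descent keeps 8 / 10 of it, hence 72. *)
  have : alpha ^+ 2 * (90 * w ^+ 2) <= alpha ^+ 2 * (100 * (gamma ^+ 2 * (mu * u))).
    by have := mulr_ge0 (sqr_ge0 alpha) (sqr_ge0 w); lra.
  rewrite ler_pM2l ?exprn_gt0 // => wle.
  have := ler_wpM2l (sqr_ge0 gamma) b_le; lra.
right; have amu : alpha ^+ 2 * mu <= 4 * gamma ^+ 2 * u.
  by rewrite -muM [mu * M]mulrC mulrA ler_wpM2r.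
have amue := ler_wpM2r e0 amu.
have gue : gamma ^+ 2 * (u * eta) <= gamma ^+ 2 * (21 * eta * eta).
  by rewrite ler_wpM2l ?sqr_ge0 // ler_wpM2r.
have := ler_wpM2l (sqr_ge0 alpha) b_le; have := small ue.
have := mulr_ge0 (sqr_ge0 alpha) (mulr_ge0 mu0 u0); lra.
Qed.

(** * Error recursion with thresholding *)

Section Iteration.
Context {R : realType} {N1 N2 m : nat} (ch : forall Z : 'M[R]_(N1, N2), svd Z).
Context (A : {linear 'M[R]_(N1, N2) -> 'cV[R]_m})
  (Astar : 'cV[R]_m -> 'M[R]_(N1, N2)).
Context (adjA : is_adjoint A Astar).
Context (r s t : nat) (alpha beta gamma : R).
Context (Alo : rip_lower A (t + s + r) alpha) (Aup : rip_upper A (t + s + r) beta).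
Context (gamma_ge1 : 1 <= gamma) (bga : beta <= gamma * alpha).
Context (sE : s%:R = 100 * gamma ^+ 4 * r%:R :> R).
Context (tE : t%:R = 800 * gamma ^+ 12 * s%:R :> R).
Context (x : 'M[R]_(N1, N2)) (e : 'cV[R]_m) (rx : (\rank x <= r)%N).

Local Notation iterate n := (iht ch A Astar s t gamma (A x + e) n).

Lemma mxrank_iht n : (\rank (iterate n) <= s)%N.
Proof. by case: n => [|n]; rewrite ?mxrank0 ?mxrank_H. Qed.

(** Thresholding costs a factor [1 + 1 / (4 gamma^2)]: the gain 72 drops by 25 to 47, and 1000
    becomes at most [1000 * 5 / 4]. Passing from [alpha] to [beta] costs another [gamma^2]. *)
Lemma iht_contraction n :
  100 * (gamma ^+ 2 * frob_dot (x - iterate n.+1) (x - iterate n.+1)) <=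
    (100 * gamma ^+ 2 - 47) * frob_dot (x - iterate n) (x - iterate n) \/
  beta ^+ 2 * frob_dot (x - iterate n.+1) (x - iterate n.+1) <=
    1250 * gamma ^+ 4 * l1norm e ^+ 2.
Proof.
have [alpha_gt0 AloW] := Alo; have [beta_gt0 AupW] := Aup.
rewrite /=; have rX := mxrank_iht n; set X := iterate n in rX *.
set v := A x + e - A X; set D := iht_dir _ _ _ _ _ _.
set mu := iht_step _ _ _ _ _ _ _.
have rW : (\rank (X - x)%R <= s + r)%N.
  apply: leq_trans (mxrank_add _ _) _; rewrite mxrank_opp; exact: leq_add.
have rW' : (\rank (X - x)%R <= t + s + r)%N.
  by apply: leq_trans rW _; rewrite -addnA leq_addl.
have tk : (t <= t + s + r)%N by rewrite -addnA leq_addr.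
have rD : (\rank D <= t + s + r)%N by apply: leq_trans tk; apply: mxrank_H.
have AW : A (X - x) = e - v.
  by rewrite linearB /v; apply/matrixP => i j; rewrite !mxE; ring.
have g2 : 1 <= gamma ^+ 2 by rewrite exprn_ege1.
have r0 : 0 <= r%:R :> R := ler0n _ _.
have s0 : 0 <= s%:R :> R := ler0n _ _.
(* [s + r <= 2 s], and [t = 800 gamma^12 s >= 400 gamma^2 (2 s)]. *)
have gap : 400 * gamma ^+ 2 * (\rank (X - x)%R)%:R <= t%:R :> R.
  have rs : r%:R <= s%:R :> R.
    have : 1 <= gamma ^+ 4 by rewrite exprn_ege1.
    move=> g4; have := ler_wpM2r r0 g4; rewrite sE; lra.
  apply: le_trans (_ : 400 * gamma ^+ 2 * (2 * s%:R) <= _).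
    rewrite ler_wpM2l //; first by lra.
    apply: (le_trans (y := (s + r)%N%:R)); first by rewrite ler_nat.
    by rewrite natrD; lra.
  have := ler_wpM2r s0 (ler_weXn2l gamma_ge1 (isT : 2 <= 12)%N); rewrite tE; lra.
have Dc := frob_dot_dir ch adjA Alo Aup tk rW' gamma_ge1 bga gap AW.
rewrite -[H ch t _]/D in Dc.
have aw : alpha * frob_norm (X - x) <= l1norm v + l1norm e.
  apply: le_trans (AloW _ rW') _; rewrite AW addrC.
  by apply: le_trans (ler_l1normD _ _) _; rewrite l1normN addrC.
pose V := X + mu *: D.
have bE : frob_dot (x - V) (x - V) = frob_norm (X - x) ^+ 2
    + 2 * mu * frob_dot D (X - x) + mu ^+ 2 * frob_dot D D.
  rewrite sqr_frob_norm (_ : x - V = - ((X - x) - (- mu) *: D)); last first.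
    by apply/matrixP => i j; rewrite !mxE; ring.
  rewrite frob_dotNl frob_dotNr opprK (frob_sqrB (X - x)) !frob_dotZl !frob_dotZr.
  rewrite (frob_dotC (X - x) D); ring.
have stepP : (frob_dot D (X - x) = 0 /\ frob_dot D D = 0) \/
    exists M, [/\ mu = l1norm v / M, frob_dot D D <= M,
      alpha ^+ 2 <= 4 * gamma ^+ 2 * M & M <= beta ^+ 2].
  have [D0|/frob_norm_gt0 D_gt0] := eqVneq D 0.
    by left; rewrite D0 -(scale0r 0) !frob_dotZl !mul0r.
  (* The second entry of the maximum keeps [M] at least [alpha^2 / (4 gamma^2)], which caps the
     stepsize; both entries are at most [beta^2]. *)
  right; exists (Num.max (frob_norm D ^+ 2)
     ((4 * gamma ^+ 2)^-1 * (l1norm (A D) ^+ 2 / frob_norm D ^+ 2))).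
  have D2_gt0 : 0 < frob_norm D ^+ 2 by rewrite exprn_gt0.
  have g4 : 0 < 4 * gamma ^+ 2 by lra.
  have AD0 : 0 <= l1norm (A D) := l1norm_ge0 _.
  split => //; first by rewrite -sqr_frob_norm le_max lexx.
    apply: le_trans (ler_wpM2l (ltW g4) (_ : (4 * gamma ^+ 2)^-1 *
      (l1norm (A D) ^+ 2 / frob_norm D ^+ 2) <= _)); last first.
      by rewrite le_max lexx orbT.
    rewrite mulVKf ?gt_eqF //.
    rewrite ler_pdivlMr // -exprMn ler_pXn2r ?nnegrE ?AloW //.
    by rewrite mulr_ge0 ?frob_norm_ge0 // ltW.
  rewrite ge_max; apply/andP; split.
    have := le_trans (frob_H_dir ch adjA v tk) (AupW D rD).
    rewrite -[H ch t _]/D -sqr_frob_norm => DD.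
    rewrite ler_pXn2r ?nnegrE ?frob_norm_ge0 ?(ltW beta_gt0) //.
    by rewrite -(ler_pM2r D_gt0) -expr2.
  apply: le_trans (_ : l1norm (A D) ^+ 2 / frob_norm D ^+ 2 <= _).
    by rewrite ler_piMl ?divr_ge0 ?sqr_ge0 // invf_le1 //; lra.
  rewrite ler_pdivrMr // -exprMn ler_pXn2r ?nnegrE ?AupW //.
  by rewrite mulr_ge0 ?frob_norm_ge0 // ltW.
have contr : 4 * gamma ^+ 2 * frob_dot (x - H ch s V) (x - H ch s V) <=
    (4 * gamma ^+ 2 + 1) * frob_dot (x - V) (x - V).
  apply: H_contraction => //; rewrite sE -exprM ler_wpM2l ?ler_nat //.
  by rewrite exprM mulr_ge0 ?sqr_ge0.
have {stepP} [M stepP] : exists M,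
    (frob_dot D (X - x) = 0 /\ frob_dot D D = 0) \/
    [/\ mu = l1norm v / M, frob_dot D D <= M,
      alpha ^+ 2 <= 4 * gamma ^+ 2 * M & M <= beta ^+ 2].
  by case: stepP => [?|[M ?]]; [exists 0; left|exists M; right].
have := step_arith alpha_gt0 bga gamma_ge1 (frob_norm_ge0 _) (l1norm_ge0 _)
  (l1norm_ge0 _) (frob_dot_ge0 _) (ltW beta_gt0) aw Dc bE stepP.
have -> : frob_dot (x - X) (x - X) = frob_norm (X - x) ^+ 2.
  by rewrite sqr_frob_norm -opprB frob_dotNl frob_dotNr opprK.
have := frob_dot_ge0 (x - H ch s V); have := frob_dot_ge0 (x - V).
move: contr; rewrite -/V; set a := frob_dot (x - H ch s V) _.
set b := frob_dot (x - V) _; set w2 := frob_norm _ ^+ 2 => contr b0 a0.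
have w0 : 0 <= w2 by exact: sqr_ge0.
case=> [bw|be]; [left|right].
  have g_gt0 : 0 < 4 * gamma ^+ 2 by lra.
  rewrite -(ler_pM2l g_gt0).
  have h1 : 0 <= 4 * gamma ^+ 2 + 1 by lra.
  have := ler_wpM2l h1 bw.
  have := ler_wpM2l (sqr_ge0 gamma) contr.
  nra.
have b2 : beta ^+ 2 <= gamma ^+ 2 * alpha ^+ 2.
  rewrite -exprMn ler_pXn2r // nnegrE; first exact: ltW.
  exact: le_trans (ltW beta_gt0) bga.
have ab : 4 * a <= 5 * b.
  have g_gt0 : 0 < gamma ^+ 2 by lra.
  rewrite -(ler_pM2l g_gt0); have := ler_wpM2r b0 g2; lra.
have := ler_wpM2r a0 b2.
have := ler_wpM2l (mulr_ge0 (sqr_ge0 gamma) (sqr_ge0 alpha)) ab.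
have := ler_wpM2l (sqr_ge0 gamma) be.
rewrite (_ : 4 = 2 + 2)%N // exprD; lra.
Qed.

(** Each step either contracts by [rho = 1 - 47 / (100 gamma^2)] or lands below the noise level, and
    [rho < 1] keeps that level from accumulating. *)
Lemma iht_bound : exists2 rho : R, 0 <= rho < 1 & forall n,
  frob_dot (x - iterate n) (x - iterate n) <=
  rho ^+ n * frob_dot x x + (36 * gamma ^+ 2 / beta * l1norm e) ^+ 2.
Proof.
have [beta_gt0 _] := Aup; have b2 : 0 < beta ^+ 2 by rewrite exprn_gt0.
have g2 : 1 <= gamma ^+ 2 by rewrite exprn_ege1.
have g0 : 0 < 100 * gamma ^+ 2 by lra.
pose rho := (100 * gamma ^+ 2 - 47) / (100 * gamma ^+ 2).
have rho01 : 0 <= rho < 1.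
  by rewrite divr_ge0 ?ltr_pdivrMr ?mul1r //=; lra.
exists rho => //; set K := (_ * l1norm e) ^+ 2.
have K0 : 0 <= K := sqr_ge0 _.
have x0 := frob_dot_ge0 x.
case/andP: rho01 => rho0 rho1.
elim=> [|n IHn]; first by rewrite /= subr0 expr0 mul1r lerDl.
have [an|an] := iht_contraction n.
  rewrite mulrA in an.
  have {}an : frob_dot (x - iterate n.+1) (x - iterate n.+1) <=
      rho * frob_dot (x - iterate n) (x - iterate n).
    by rewrite /rho mulrAC ler_pdivlMr // mulrC.
  apply: le_trans an _; apply: le_trans (ler_wpM2l rho0 IHn) _.
  by rewrite mulrDr exprS mulrA lerD2l ler_piMl // ltW.
apply: le_trans (_ : K <= _); last first.
  by rewrite lerDr mulr_ge0 ?exprn_ge0.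
rewrite -(ler_pM2l b2); apply: le_trans an _.
(* [36^2 = 1296] is the first square above 1250. *)
have -> : beta ^+ 2 * K = 1296 * gamma ^+ 4 * l1norm e ^+ 2.
  by rewrite /K; field; rewrite gt_eqF.
by have := mulr_ge0 (exprn_ge0 4 (le_trans ler01 gamma_ge1)) (sqr_ge0 (l1norm e)); lra.
Qed.

End Iteration.

(** * Passage to cluster points *)

Lemma continuous_frob_dist (R : realType) p q (x : 'M[R]_(p, q)) :
  continuous (fun Z : 'M[R]_(p, q) => frob_dot (x - Z) (x - Z)).
Proof.
have cx i j : continuous (fun Z : 'M[R]_(p, q) => (x - Z) i j).
  have -> : (fun Z : 'M[R]_(p, q) => (x - Z) i j) = (fun Z => x i j - Z i j).
    by apply/funext => Z; rewrite !mxE.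
  by move=> Z; apply: continuousB; [exact: cst_continuous|exact: coord_continuous].
apply: continuous_big => [|i _]; first exact: add_continuous.
apply: continuous_big => [|j _ Z]; first exact: add_continuous.
by apply: continuousM; exact: cx.
Qed.

(** For each [eps > 0] the closed set where [f <= B + eps] contains a tail of the sequence, hence
    all its cluster points. *)
Lemma cluster_le (R : realType) (T : topologicalType) (f : T -> R)
    (u : nat -> T) (y : T) (B : R) (v : nat -> R) :
  continuous f -> cluster (u n @[n --> \oo]) y ->
  (forall n, f (u n) <= v n) -> v n @[n --> \oo] --> B -> f y <= B.
Proof.
move=> fc yc fuv vB; apply/ler_addgt0Pr => eps eps_gt0.
have cl : closed (f @^-1` [set b | b <= B + eps]).
  by apply: preimage_closed => [z _|]; [exact: fc|exact: closed_le].
suff : closure (f @^-1` [set b | b <= B + eps]) y by move/cl.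
move: yc; rewrite clusterE; apply.
have : \forall n \near \oo, v n < B + eps by apply: (cvgr_lt B vB); rewrite ltrDl.
by apply: filterS => n /ltW; apply: le_trans; exact: fuv.
Qed.

Theorem theorem5 (R : realType) :
  exists d : R -> R -> R,
  forall (N1 N2 m r s t : nat) (gamma : R)
    (A : {linear 'M[R]_(N1, N2) -> 'cV[R]_m})
    (Astar : 'cV[R]_m -> 'M[R]_(N1, N2))
    (ch : forall Z : 'M[R]_(N1, N2), svd Z),
  (0 < N1)%N -> (0 < N2)%N -> (0 < m)%N -> (0 < r)%N ->
  1 <= gamma ->
  s%:R = 100 * gamma ^+ 4 * r%:R ->
  t%:R = 800 * gamma ^+ 12 * s%:R ->
  mrip A (t + s + r) ->
  rip_gamma A (t + s + r) <= gamma ->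
  is_adjoint A Astar ->
  forall (X : 'M[R]_(N1, N2)) (e : 'cV[R]_m) (Xsharp : 'M[R]_(N1, N2)),
  cluster (iht ch A Astar s t gamma (A X + e) n @[n --> \oo]) Xsharp ->
  frob_norm (H ch r X - Xsharp) <=
    d gamma (rip_beta A (t + s + r)) * l1norm (A (X - H ch r X) + e).
Proof.
exists (fun gamma beta => 36 * gamma ^+ 2 / beta).
move=> N1 N2 m r s t gamma A Astar ch N1_gt0 N2_gt0 m_gt0 r_gt0 g1 sE tE ripA gA.
move=> adjA X e Xsharp.
have k_gt0 : (0 < t + s + r)%N by rewrite addn_gt0 r_gt0 orbT.
have Alo := rip_alphaP N1_gt0 N2_gt0 k_gt0 ripA.
have Aup := rip_betaP N1_gt0 N2_gt0 k_gt0 ripA.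
have bga := rip_gamma_le Alo Aup gA.
set x := H ch r X; set e' := A (X - x) + e.
(* The low-rank [x] becomes the signal, and the image of [X - x] joins the noise. *)
have -> : A X + e = A x + e' by rewrite /e' linearB addrA addrCA subrr addr0.
move=> cX; have rx : (\rank x <= r)%N := mxrank_H _ _ _.
have [rho /andP[rho0 rho1] bnd] := iht_bound ch adjA Alo Aup g1 bga sE tE e' rx.
set B := (_ * l1norm e') ^+ 2 in bnd.
have rhoB : rho ^+ n * frob_dot x x + B @[n --> \oo] --> B.
  rewrite -[X in _ --> X]add0r; apply: cvgD; last exact: cvg_cst.
  rewrite -(mul0r (frob_dot x x)); apply: cvgMr_tmp; apply: cvg_expr.
  by rewrite ger0_norm.
have := cluster_le (@continuous_frob_dist _ _ _ x) cX bnd rhoB.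
have [beta_gt0 _] := Aup.
rewrite -sqr_frob_norm ler_pXn2r ?nnegrE ?frob_norm_ge0 //.
have g0 := le_trans ler01 g1.
by rewrite mulr_ge0 ?l1norm_ge0 // divr_ge0 ?(ltW beta_gt0) // mulr_ge0 ?exprn_ge0.
Qed.
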